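(* Let $d\ge 2$, let $\mathbb{G}$ be a unitary two-design consisting of $d\times d$ unitaries, and let $\{\tilde{\mathcal{G}}: G\in\mathbb{G}\}$ be a corresponding set of Hermiticity-preserving linear maps on $\mathbb{C}^{d\times d}$ (one for each $G\in\mathbb{G}$). Let $p$ and $t$ be the largest eigenvalues in absolute value of $\mathbb{E}_{G\in\mathbb{G}}(\mathcal{G}_{\mathrm{u}}\otimes\tilde{\mathcal{G}})$ and $\mathbb{E}_{G\in\mathbb{G}}(\tilde{\mathcal{G}})$ respectively, where $\mathcal{G}(A)=GAG^{\dagger}$ and $\mathcal{G}_{\mathrm{u}}(A)=\mathcal{G}\left(A-\frac{\mathrm{Tr}(A)}{d}I_d\right)$. Then there exist linear maps $\mathcal{L}$ and $\mathcal{R}$ on $\mathbb{C}^{d\times d}$ such that $$\mathbb{E}_{G\in\mathbb{G}}(\tilde{\mathcal{G}}\,\mathcal{L}\,\mathcal{G}^{\dagger})=\mathcal{L}\,\mathcal{D}_{p,t},\qquad \mathbb{E}_{G\in\mathbb{G}}(\mathcal{G}^{\dagger}\,\mathcal{R}\,\tilde{\mathcal{G}})=\mathcal{D}_{p,t}\,\mathcal{R},\qquad \mathbb{E}_{G\in\mathbb{G}}(\mathcal{G}\,\mathcal{R}\,\mathcal{L}\,\mathcal{G}^{\dagger})=\mathcal{D}_{p,t}.$$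
   Context: Conventions. $I_d$ is the $d\times d$ identity matrix. Linear maps on $\mathbb{C}^{d\times d}$ (''channels'') are composed by juxtaposition: $\mathcal{C}\mathcal{B}(A)=\mathcal{C}[\mathcal{B}(A)]$. For a finite set $\mathbb{X}$, $\mathbb{E}_{x\in\mathbb{X}}f(x)=|\mathbb{X}|^{-1}\sum_{x\in\mathbb{X}}f(x)$. For a unitary $G$, $\mathcal{G}(A)=GAG^{\dagger}$ is the ideal unitary channel and $\mathcal{G}^{\dagger}(A)=G^{\dagger}AG$ is its inverse (and its adjoint for the Hilbert–Schmidt inner product $\mathrm{Tr}(A^{\dagger}B)$). A linear map on $\mathbb{C}^{d\times d}$ is Hermiticity-preserving if it sends Hermitian matrices to Hermitian matrices. The map $\tilde{\mathcal{G}}$ models a noisy implementation of $\mathcal{G}$, and may depend on $G$ arbitrarily. Matrix representation. Linear maps on $\mathbb{C}^{d\times d}$ are identified with $d^2\times d^2$ matrices with respect to a fixed orthonormal basis $B_1=I_d/\sqrt{d},B_2,\dots,B_{d^2}$ of Hermitian matrices ($\mathrm{Tr}(B_j^{\dagger}B_k)=\delta_{jk}$), so that Hermiticity-preserving maps are real matrices; tensor products and eigenvalues of maps refer to these matrices (equivalently, to the linear operators themselves). Unitary two-design. $\mathbb{G}$ is a finite group of $d\times d$ unitary matrices (elements identified up to a global phase) such that uniform sampling from $\mathbb{G}$ reproduces the first and second moments of the Haar measure; equivalently, for every linear map $\mathcal{C}$ on $\mathbb{C}^{d\times d}$, $\mathbb{E}_{G\in\mathbb{G}}(\mathcal{G}^{\dagger}\mathcal{C}\mathcal{G})=\int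 dU\,\mathcal{U}^{\dagger}\mathcal{C}\,\mathcal{U}$, where $\mathcal{U}(A)=UAU^{\dagger}$ and $dU$ is the Haar probability measure on the unitary group. Depolarizing maps. For scalars $p,t$, $\mathcal{D}_{p,t}$ is the linear map $\mathcal{D}_{p,t}(A)=t\,\frac{\mathrm{Tr}(A)}{d}I_d+p\left(A-\frac{\mathrm{Tr}(A)}{d}I_d\right)$.
   Formalization: Added assumption: if p (resp. t) is nonzero, its algebraic and geometric multiplicities as an eigenvalue of the averaged map are equal; otherwise the claim fails, e.g. for G̃ = M constant with a single 2×2 Jordan block at 1 involving the identity and zeros elsewhere (then p = 0, t = 1). *)

(* Defs.v *)
From HB Require Import structures.
From mathcomp Require Import all_boot all_order all_algebra all_fingroup.
From mathcomp Require Import sesquilinear spectral.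
From mathcomp Require Import all_classical all_reals all_analysis.
From mathcomp Require Import complex mxtens.

Set Implicit Arguments.
Unset Strict Implicit.
Unset Printing Implicit Defensive.

Import Order.TTheory GRing.Theory Num.Theory.
Import numFieldNormedType.Exports.

Local Open Scope ring_scope.
Local Open Scope sesquilinear_scope.

(* The complex numbers, packed so that the instances on a numFieldType (in
   particular its topology) apply to them and to matrices over them. *)
Definition Cplx (R : realType) : numClosedFieldType := R[i].

Section Expectation.
Variables (C : numClosedFieldType) (X : finType) (V : lmodType C).

Definition expect (f : X -> V) : V := (#|X|%:R : C)^-1 *: \sum_x f x.

End Expectation.

Section Maps.
Variables (C : numClosedFieldType) (d : nat).
Implicit Types (A U : 'M[C]_d) (f : 'End('M[C]_d)) (p t : C).

Definition unitary_channel U : 'End('M[C]_d) := linfun (mulmxr (U^t*) \o mulmx U).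

Lemma unitary_channelE U A : unitary_channel U A = U *m A *m U^t*.
Proof. by rewrite lfunE. Qed.

Definition unitary_channel_adj U : 'End('M[C]_d) := unitary_channel (U^t*).

Lemma unitary_channel_adjE U A : unitary_channel_adj U A = U^t* *m A *m U.
Proof.
rewrite unitary_channelE; congr (_ *m _).
by apply/matrixP=> i j; rewrite !mxE conjCK.
Qed.

Definition trace_part A : 'M[C]_d := (\tr A / d%:R)%:M.

Fact trace_part_is_linear : linear trace_part.
Proof.
move=> a A B; rewrite /trace_part linearP mulrDl /= -mulrA.
by rewrite raddfD /= scale_scalar_mx.
Qed.

HB.instance Definition _ :=
  GRing.isLinear.Build C 'M[C]_d 'M[C]_d *:%R trace_part trace_part_is_linear.

Definition trace_proj : 'End('M[C]_d) := linfun trace_part.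
Definition traceless_proj : 'End('M[C]_d) := \1%VF - trace_proj.

Definition depolarizing p t : 'End('M[C]_d) :=
  t *: trace_proj + p *: traceless_proj.

Lemma depolarizingE p t A :
  depolarizing p t A
    = t *: (\tr A / d%:R)%:M + p *: (A - (\tr A / d%:R)%:M).
Proof. by rewrite !(add_lfunE, scale_lfunE, opp_lfunE, id_lfunE, lfunE) /=. Qed.

Definition unitary_channel_u U : 'End('M[C]_d) :=
  (unitary_channel U \o traceless_proj)%VF.

Lemma unitary_channel_uE U A :
  unitary_channel_u U A = unitary_channel U (A - (\tr A / d%:R)%:M).
Proof.
by rewrite comp_lfunE !(add_lfunE, opp_lfunE, id_lfunE) [trace_proj A]lfunE.
Qed.

Definition hermiticity_preserving f :=
  forall A, A \is hermsymmx -> f A \is hermsymmx.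

Definition hermitian_basis (B : 'I_(d ^ 2) -> 'M[C]_d) :=
  [/\ forall j, B j \is hermsymmx,
      forall j k, \tr ((B j)^t* *m B k) = (j == k)%:R
    & forall j, val j = 0%N -> B j = (sqrtC d%:R)^-1%:M].

Definition matrix_of (B : 'I_(d ^ 2) -> 'M[C]_d) f : 'M[C]_(d ^ 2) :=
  \matrix_(j, k) \tr ((B j)^t* *m f (B k)).

(* The elements of a finite group of unitaries taken up to a global phase are
   represented by a choice of phases, hence multiply up to a phase only. *)
Definition unitary_group_mod_phase (gT : finGroupType) (U : gT -> 'M[C]_d) :=
  [/\ forall g, U g \is unitarymx,
      forall g h, exists2 c : C, `|c| = 1 & U (g * h)%g = c *: (U g *m U h)
    & forall g h (c : C), `|c| = 1 -> U g = c *: U h -> g = h].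

End Maps.

Section Eigenvalues.
Variables (C : numClosedFieldType) (n : nat).
Implicit Types (M : 'M[C]_n) (a : C).

Definition largest_eigenvalue M a :=
  eigenvalue M a /\ forall b, eigenvalue M b -> `|b| <= `|a|.

(* The algebraic and geometric multiplicities of a coincide. A defective nonzero
   eigenvalue can have all its left eigenvectors orthogonal to all its right
   ones; for the average of maps that do not depend on the group element (a
   fixed Jordan block, say) this rules out the normalization of R L. *)
Definition nondefective M a :=
  mup a (char_poly M) = \rank (eigenspace M a).

End Eigenvalues.

Section Haar.
Variables (R : realType) (d : nat).
Local Notation C := (Cplx R).

Definition borel_mx := g_sigma_algebraType (@open 'M[C]_d).

(* The Haar probability measure of the unitary group, as a Borel measure on all
   matrices that is carried by the unitary ones. *)
Definition haar_unitary (mu : probability borel_mx R) :=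
  mu [set V : 'M[C]_d | V \is unitarymx]%classic = 1%E /\
  forall V : 'M[C]_d, V \is unitarymx ->
    forall S : set borel_mx, measurable S ->
      mu ((fun W : 'M[C]_d => V *m W) @^-1` S)%classic = mu S /\
      mu ((fun W : 'M[C]_d => W *m V) @^-1` S)%classic = mu S.

Definition integral_unitary (mu : probability borel_mx R)
    (f : 'M[C]_d -> C) : C :=
  Complex
    (\int[mu]_(V in [set V : 'M[C]_d | V \is unitarymx]%classic)
       complex.Re (f V : R[i]))%R
    (\int[mu]_(V in [set V : 'M[C]_d | V \is unitarymx]%classic)
       complex.Im (f V : R[i]))%R.

Definition two_design (mu : probability borel_mx R)
    (gT : finGroupType) (U : gT -> 'M[C]_d) :=
  forall (f : 'End('M[C]_d)) (A : 'M[C]_d) (i j : 'I_d),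
    expect (fun g =>
      unitary_channel_adj (U g) \o f \o unitary_channel (U g))%VF A i j
    = integral_unitary mu (fun V =>
        (unitary_channel_adj V \o f \o unitary_channel V)%VF A i j).

End Haar.

(* Main.v *)
(** Write L = Lt + Lu and R = Rt + Ru, where Lt kills traceless matrices and Lu
    kills the identity, and dually for the ranges of Rt and Ru. The trace parts
    are built from a right and a left eigenvector of the average of the noisy
    maps, the traceless parts from reshaped right and left eigenvectors of the
    average of the tensor products; this gives the first two identities.
    Nondefectiveness says that the left and right eigenvectors can be paired to
    a nonzero value, which fixes the two traces of R L. By Haar invariance, the
    twirl of R L commutes with conjugation by every unitary, hence with every
    commutator [X, .], hence is a combination of the identity and of
    A |-> tr(A) 1; such a map is determined by its two traces. *)
Require Import Defs.
From HB Require Import structures.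
From mathcomp Require Import all_boot all_order all_algebra all_fingroup.
From mathcomp Require Import sesquilinear spectral.
From mathcomp Require Import all_classical all_reals all_analysis.
From mathcomp Require Import complex mxtens.
From mathcomp Require Import measurable_realfun ring.

Import Order.TTheory GRing.Theory Num.Theory.
Import numFieldNormedType.Exports.
Local Open Scope ring_scope.
Local Open Scope sesquilinear_scope.

Set Implicit Arguments.
Unset Strict Implicit.

(** * Haar invariance *)

(** The norm of [K] takes values in [K] and that of the target in [R], hence a modulus [e_] from [R]
    to [K]. *)
Lemma uniform_modulus_continuous (K : numFieldType) (R : realFieldType)
    (f : K -> R) (e_ : R -> K) :
  (forall e, 0 < e -> 0 < e_ e) ->
  (forall e x y, `|x - y| < e_ e -> `|f x - f y| < e) -> continuous f.
Proof.
move=> e_gt0 fe x s /= /nbhs_ballP [e e0 es].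
apply/nbhs_ballP; exists (e_ e) => /=; first exact: e_gt0.
by move=> y xy; apply: es; apply: fe.
Qed.

Lemma continuous_conjC (K : numClosedFieldType) : continuous (fun x : K => x^*).
Proof.
move=> x s /= /nbhs_ballP [e e0 es]; apply/nbhs_ballP; exists e => // y.
by rewrite /ball /= -norm_conjC rmorphB => xy; apply: es.
Qed.

Section Continuity.
Variables (R : realType).
Local Notation C := (Cplx R).

Lemma continuous_ReC : continuous (fun x : C => complex.Re (x : R[i])).
Proof.
apply: (@uniform_modulus_continuous C R _ (fun e => e%:C%C)) => [e|e].
  by rewrite ltcR.
move=> [a b] [c d]; rewrite normc_def ltcR /=; apply: le_lt_trans.
by rewrite -sqrtr_sqr ler_wsqrtr// lerDl sqr_ge0.
Qed.

Lemma continuous_ImC : continuous (fun x : C => complex.Im (x : R[i])).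
Proof.
apply: (@uniform_modulus_continuous C R _ (fun e => e%:C%C)) => [e|e].
  by rewrite ltcR.
move=> [a b] [c d]; rewrite normc_def ltcR /=; apply: le_lt_trans.
by rewrite -sqrtr_sqr ler_wsqrtr// lerDr sqr_ge0.
Qed.

End Continuity.

Section MatrixContinuity.
Variable C : numClosedFieldType.

Lemma continuous_mx (T : topologicalType) m n (f : T -> 'M[C]_(m, n)) :
  (forall i j, continuous (fun x => f x i j)) -> continuous f.
Proof.
move=> cf x; apply/cvg_ballP => e e0; near=> y.
split=> // i j; move: i j; near: y.
apply: filter_forall => i; apply: filter_forall => j.
by move/cvg_ballP: (cf i j x); apply.
Unshelve. all: by end_near. Qed.

Lemma continuous_coord (T : topologicalType) m n (f : T -> 'M[C]_(m, n)) i j :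
  continuous f -> continuous (fun x => f x i j).
Proof.
move=> cf x.
exact: (continuous_comp (cf x) (@coord_continuous _ _ _ i j (f x))).
Qed.

Lemma continuous_mulmx (T : topologicalType) m n k
    (f : T -> 'M[C]_(m, n)) (g : T -> 'M[C]_(n, k)) :
  continuous f -> continuous g -> continuous (fun x => f x *m g x).
Proof.
move=> cf cg; apply: continuous_mx => i j.
under eq_fun do rewrite mxE.
apply: continuous_big => [|l _ x]; first exact: add_continuous.
by apply: continuousM; apply: continuous_coord.
Qed.

Lemma continuous_adjmx (m n : nat) :
  continuous (fun A : 'M[C]_(m, n) => A^t*).
Proof.
apply: continuous_mx => i j.
under eq_fun do rewrite !mxE.
move=> A; exact: (continuous_comp (@coord_continuous _ _ _ _ _ A)
  (@continuous_conjC _ _)).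
Qed.

(** Expanding the argument on elementary matrices writes the image as a finite sum of coordinates
    times constants. *)
Lemma continuous_lfun (T : topologicalType) m n k l
    (f : 'Hom('M[C]_(m, n), 'M[C]_(k, l))) (g : T -> 'M[C]_(m, n)) :
  continuous g -> continuous (fun x => f (g x)).
Proof.
move=> cg; apply: continuous_mx => i j.
under eq_fun do rewrite [g _]matrix_sum_delta linear_sum summxE.
apply: continuous_big => [|r _]; first exact: add_continuous.
under eq_fun do rewrite linear_sum summxE.
apply: continuous_big => [|s _]; first exact: add_continuous.
under eq_fun do rewrite linearZ mxE.
move=> x; apply: continuousM; last exact: cst_continuous.
exact: continuous_coord.
Qed.

End MatrixContinuity.

Lemma unitarymx_mulmxl (C : numClosedFieldType) n (W V : 'M[C]_n) :
  W \is unitarymx -> (W *m V \is unitarymx) = (V \is unitarymx).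
Proof.
move=> Wu; apply/idP/idP => [WVu|]; last exact: mul_unitarymx.
have /mulmx1C WW : W *m W^t* = 1%:M by apply/unitarymxP.
rewrite -[V]mul1mx -WW -mulmxA; apply: mul_unitarymx => //.
by rewrite trmxC_unitary.
Qed.

Section HaarInvariance.
Variables (R : realType) (d : nat).
Local Notation C := (Cplx R).
Local Notation borel_mx := (borel_mx R d).

Lemma borel_continuous_measurable (f : 'M[C]_d -> R) :
  continuous f -> measurable_fun [set: borel_mx] (f : borel_mx -> R).
Proof.
move=> /continuousP cf; apply: (measurability _ (RGenOpens.measurableE R)).
move=> _ [_ [a [b ->] <-]]; rewrite setTI; apply: sub_sigma_algebra.
exact/cf/interval_open.
Qed.

Lemma borel_mx_continuous_measurable (f : 'M[C]_d -> 'M[C]_d) :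
  continuous f -> measurable_fun [set: borel_mx] (f : borel_mx -> borel_mx).
Proof.
move=> /continuousP cf.
apply: (@measurability _ _ borel_mx borel_mx _ _ (@open 'M[C]_d)) => //.
by move=> _ [A oA <-]; rewrite setTI; apply: sub_sigma_algebra; apply: cf.
Qed.

(** The unitary matrices form a closed set, the preimage of [1%:M] under a continuous map. *)
Lemma measurable_unitarymx :
  measurable ([set V : 'M[C]_d | V \is unitarymx]%classic : set borel_mx).
Proof.
pose f (V : 'M[C]_d) := V *m V^t*.
have cf : continuous f.
  by apply: continuous_mulmx => [x //|]; apply: continuous_adjmx.
have -> : [set V : 'M[C]_d | V \is unitarymx]%classic =
    (f @^-1` [set 1%:M])%classic.
  by apply/seteqP; split => V /= /unitarymxP.
rewrite -[X in measurable X]setCK; apply: measurableC; apply: sub_sigma_algebra.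
rewrite openC; apply: closed_comp => [x _|]; first exact: cf.
exact/accessible_closed_set1/hausdorff_accessible/norm_hausdorff.
Qed.

Variables (mu : probability borel_mx R) (mu_haar : haar_unitary mu).

(** Change of variables: left invariance identifies [mu] with its pushforward under multiplication
    by [W], and the set of unitary matrices is its own preimage. *)
Lemma haar_ge0_integral (W : 'M[C]_d) (h : borel_mx -> \bar R) :
  W \is unitarymx -> measurable_fun [set: borel_mx] h -> (forall V, 0 <= h V)%E ->
  (\int[mu]_(V in [set V : 'M[C]_d | V \is unitarymx]%classic) h (W *m V) =
   \int[mu]_(V in [set V : 'M[C]_d | V \is unitarymx]%classic) h V)%E.
Proof.
move=> Wu mh h0.
pose D : set borel_mx := [set V : 'M[C]_d | V \is unitarymx]%classic.
rewrite -/D.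
have mD : measurable D := measurable_unitarymx.
pose phi (V : borel_mx) : borel_mx := W *m V.
have mphi : measurable_fun [set: borel_mx] phi.
  apply: borel_mx_continuous_measurable; apply: continuous_mulmx => [V|V //].
  exact: cst_continuous.
have -> : (\int[mu]_(V in D) h V = \int[pushforward mu phi]_(V in D) h V)%E.
  by apply: eq_measure_integral => A mA _; exact: esym (mu_haar.2 W Wu A mA).1.
have mhD : measurable_fun D h by exact: measurable_funS mh.
have h0D : {in D, forall V, (0 <= h V)%E} by [].
rewrite (ge0_integral_pushforward mphi mu mD mhD h0D).
have -> : (phi @^-1` D)%classic = D; last reflexivity.
by apply/seteqP; split => V; rewrite /D /phi /= unitarymx_mulmxl.
Qed.

(** The integral is the difference of those of the positive and negative parts, and each of these is
    invariant, whether finite or not. *)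
Lemma haar_Rintegral (W : 'M[C]_d) (h : 'M[C]_d -> R) :
  W \is unitarymx -> continuous h ->
  (\int[mu]_(V in [set V : 'M[C]_d | V \is unitarymx]%classic) h (W *m V) =
   \int[mu]_(V in [set V : 'M[C]_d | V \is unitarymx]%classic) h V)%R.
Proof.
move=> Wu /borel_continuous_measurable mh; rewrite /Rintegral; congr fine.
have mEh : measurable_fun [set: borel_mx] (fun V : borel_mx => (h V)%:E).
  exact/measurable_EFinP.
rewrite integralE [RHS]integralE; congr (_ - _)%E.
  have E := haar_ge0_integral Wu (measurable_funepos mEh) (funepos_ge0 _).
  by rewrite -[RHS]E; apply: eq_integral => V _; rewrite !funeposE.
have E := haar_ge0_integral Wu (measurable_funeneg mEh) (funeneg_ge0 _).
by rewrite -[RHS]E; apply: eq_integral => V _; rewrite !funenegE.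
Qed.

Lemma haar_integral_unitary (W : 'M[C]_d) (f : 'M[C]_d -> C) :
  W \is unitarymx -> continuous f ->
  integral_unitary mu (fun V => f (W *m V)) = integral_unitary mu f.
Proof.
move=> Wu cf; rewrite /integral_unitary; congr Complex.
  apply: (@haar_Rintegral W (fun V => complex.Re (f V : R[i]))) => // V.
  exact: (continuous_comp (cf V) (@continuous_ReC _ _)).
apply: (@haar_Rintegral W (fun V => complex.Im (f V : R[i]))) => // V.
exact: (continuous_comp (cf V) (@continuous_ImC _ _)).
Qed.

End HaarInvariance.

Section Twirl.
Variables (C : numClosedFieldType) (d : nat) (gT : finGroupType).
Implicit Types (U : gT -> 'M[C]_d) (W : 'M[C]_d) (f : 'End('M[C]_d)).

Definition conjugate_map W f : 'End('M[C]_d) :=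
  (unitary_channel_adj W \o f \o unitary_channel W)%VF.

Definition twirl U f : 'End('M[C]_d) := expect (fun g => conjugate_map (U g) f).

(** Conjugation is a right action: the inner [W] ends up to the left of [V], so it acts on the Haar
    variable by left translation. *)
Lemma conjugate_mapM W V f :
  conjugate_map V (conjugate_map W f) = conjugate_map (W *m V) f.
Proof.
apply/lfunP => A.
rewrite !comp_lfunE /unitary_channel_adj !unitary_channelE.
rewrite !(trmx_mul, map_mxM, trmxCK) /=.
by rewrite !mulmxA.
Qed.

Lemma continuous_conjugate_map f A i j :
  continuous (fun W : 'M[C]_d => conjugate_map W f A i j).
Proof.
apply: continuous_coord.
under eq_fun do rewrite !comp_lfunE unitary_channel_adjE unitary_channelE.
apply: continuous_mulmx => [|V //]; apply: continuous_mulmx.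
  exact: continuous_adjmx.
apply: continuous_lfun; apply: continuous_mulmx; last exact: continuous_adjmx.
by apply: continuous_mulmx => [V //|]; exact: cst_continuous.
Qed.

End Twirl.

(* Replacing [f] by its conjugate by [W] translates the Haar variable on the left,
   so invariance of the measure is enough; integrals need not be additive. *)
Lemma twirl_conjugate_map (R : realType) (d : nat)
    (mu : probability (borel_mx R d) R) (mu_haar : haar_unitary mu)
    (gT : finGroupType) (U : gT -> 'M[Cplx R]_d) (U_2design : two_design mu U)
    (W : 'M[Cplx R]_d) (f : 'End('M[Cplx R]_d)) :
  W \is unitarymx -> twirl U (conjugate_map W f) = twirl U f.
Proof.
move=> Wu; apply/lfunP => A; apply/matrixP => i j.
rewrite [LHS]U_2design [RHS]U_2design -[RHS](haar_integral_unitary mu_haar Wu).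
  congr integral_unitary; apply/funext => V.
  by have := conjugate_mapM W V f; rewrite /conjugate_map => ->.
exact: continuous_conjugate_map.
Qed.

(** * The commutant of unitary conjugation *)

Section Commutant.
Variables (C : numClosedFieldType) (d : nat).
Implicit Types (A X Y P : 'M[C]_d) (S : 'End('M[C]_d)).

Definition lie X A := X *m A - A *m X.

Lemma lieE X A i j : lie X A i j = (X *m A) i j - (A *m X) i j.
Proof. by rewrite !mxE. Qed.

Lemma lieDl X Y A : lie (X + Y) A = lie X A + lie Y A.
Proof. by rewrite /lie mulmxDl mulmxDr opprD addrACA. Qed.

Lemma lieZl c X A : lie (c *: X) A = c *: lie X A.
Proof. by rewrite /lie -scalemxAl -scalemxAr scalerBr. Qed.

(** Infinitesimal counterpart of commuting with conjugations. For fixed [S] the admissible [X] form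
    a subspace, so a spanning set of them suffices. *)
Definition lie_equivariant S X := forall A, S (lie X A) = lie X (S A).

Lemma lie_equivariantD S X Y :
  lie_equivariant S X -> lie_equivariant S Y -> lie_equivariant S (X + Y).
Proof. by move=> SX SY A; rewrite !lieDl linearD /= SX SY. Qed.

Lemma lie_equivariantZ S c X : lie_equivariant S X -> lie_equivariant S (c *: X).
Proof. by move=> SX A; rewrite !lieZl linearZ /= SX. Qed.

Lemma lie_equivariantB S X Y :
  lie_equivariant S X -> lie_equivariant S Y -> lie_equivariant S (X - Y).
Proof.
move=> SX SY; rewrite -scaleN1r.
exact: lie_equivariantD SX (lie_equivariantZ _ SY).
Qed.

(** The last coefficient is symmetric in [c] and [c'], so the term [P A P] cancels against the one
    obtained after exchanging the two. *)
Lemma conj_rank1 (P A : 'M[C]_d) c c' :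
  (1%:M + c *: P) *m A *m (1%:M + c' *: P) =
  A + c *: (P *m A) + c' *: (A *m P) + (c * c') *: (P *m A *m P).
Proof.
rewrite mulmxDl mul1mx mulmxDr mulmx1 mulmxDl -!scalemxAl -!scalemxAr scalerA.
by rewrite addrA; congr (_ + _); rewrite ?[c' * c]mulrC // addrAC.
Qed.

Section UnitaryEquivariant.
Variable S : 'End('M[C]_d).
Hypothesis SU : forall W A, W \is unitarymx -> S (W *m A *m W^t*) = W *m S A *m W^t*.

(* The unitaries [1 + ('i - 1) P] and their adjoints act on [A] with a difference
   of [2 'i (P A - A P)], so equivariance passes to commutators. *)
Lemma unitary_equivariant_projection P :
  P^t* = P -> P *m P = P -> lie_equivariant S P.
Proof.
move=> Ph Pp A.
have i2 : ('i : C) * 'i = -1 by rewrite -expr2 sqrCi.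
(* Conjugate numbers with [c + c' + c * c' = 0], which makes [1 + c P] unitary for an orthogonal
   projection [P]. *)
pose c : C := 'i - 1; pose c' : C := - 'i - 1.
have cc : c * c' = 2 by rewrite /c /c'; ring: i2.
have cN : c + c' = - 2 by rewrite /c /c'; ring.
have WA (a a' : C) : a^* = a' -> (1%:M + a *: P)^t* = 1%:M + a' *: P.
  by move=> <-; rewrite !linearD /= map_mxD !linearZ /= map_mxZ /= trmx1 map_mx1 Ph.
have cA : c^* = c' by rewrite /c rmorphB rmorph1 /= conjCi.
have c'A : c'^* = c by rewrite -cA conjCK.
have Wu : (1%:M + c *: P) \is unitarymx.
  apply/unitarymxP; rewrite (WA _ _ cA) mulmxDl mul1mx -scalemxAl mulmxDr mulmx1.
  rewrite -scalemxAr Pp scalerDr scalerA cc -addrA addrA -[RHS]addr0 -addrA.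
  by congr (_ + _); rewrite addrA -!scalerDl (addrC c') cN addNr scale0r.
have Wu' : (1%:M + c' *: P) \is unitarymx by rewrite -(WA _ _ cA) trmxC_unitary.
have key B : (1%:M + c *: P) *m B *m (1%:M + c *: P)^t* -
    (1%:M + c' *: P) *m B *m (1%:M + c' *: P)^t* = (c - c') *: lie P B.
  rewrite (WA _ _ cA) (WA _ _ c'A) !conj_rank1 (mulrC c') /lie.
  move: (P *m B *m P) (P *m B) (B *m P) => X Y Z.
  by apply/matrixP => i j; rewrite !mxE; ring.
have c0 : c - c' != 0.
  have -> : c - c' = 2 * 'i by rewrite /c /c'; ring.
  by rewrite mulf_neq0 ?pnatr_eq0// neq0Ci.
by apply: (scalerI c0); rewrite -key -linearZ -key linearB /= !SU.
Qed.

(** [v v^*] is the scalar [v^* v] times an orthogonal projection; the scalar is a sum of squared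
    moduli, so it vanishes only for [v = 0]. *)
Lemma unitary_equivariant_rank1 (v : 'cV[C]_d) : lie_equivariant S (v *m v^t*).
Proof.
pose s := (v^t* *m v) 0 0.
have vv : v^t* *m v = s%:M by rewrite -mx11_scalar.
have sE : s = \sum_i `|v i 0| ^+ 2.
  by rewrite /s mxE; apply: eq_bigr => i _; rewrite !mxE mulrC -normCK.
have [s0|s_neq0] := eqVneq s 0.
  have -> : v = 0.
    apply/matrixP => i j; rewrite mxE (ord1 j); apply/eqP; rewrite -normr_eq0.
    move/eqP: s0; rewrite sE psumr_eq0 => [/allP/(_ i)|k _]; last exact: exprn_ge0.
    by rewrite mem_index_enum expf_eq0 => /(_ isT).
  by rewrite mul0mx => A; rewrite /lie !(mul0mx, mulmx0) subr0 linear0.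
have -> : v *m v^t* = s *: (s^-1 *: (v *m v^t*)) by rewrite scalerA mulfV// scale1r.
apply: lie_equivariantZ; apply: unitary_equivariant_projection.
  have sr : s^* = s.
    by rewrite sE rmorph_sum; apply: eq_bigr => i _; rewrite rmorphXn /= conj_normC.
  rewrite linearZ /= map_mxZ trmx_mul map_mxM /= trmxCK.
  by rewrite fmorphV /= sr.
rewrite -scalemxAl -scalemxAr mulmxA -(mulmxA v) vv mul_mx_scalar -scalemxAl.
by congr (_ *: _); rewrite scalerA mulVf// scale1r.
Qed.

(** Sum of [c (x + c y) (x + c y)^*] over the fourth roots of unity [c]: only [x y^*] survives, as
    the sums of [c] and of [c ^ 2] vanish. *)
Lemma polarization (x y : 'cV[C]_d) :
  4 *: (x *m y^t*) =
    (x + y) *m (x + y)^t* - (x - y) *m (x - y)^t* +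
    'i *: ((x + 'i *: y) *m (x + 'i *: y)^t*) -
    'i *: ((x - 'i *: y) *m (x - 'i *: y)^t*).
Proof.
have e c : (x + c *: y) *m (x + c *: y)^t* =
    x *m x^t* + c *: (y *m x^t*) + c^* *: (x *m y^t*) + (c * c^*) *: (y *m y^t*).
  rewrite !linearD /= map_mxD linearZ /= map_mxZ mulmxDl !mulmxDr.
  rewrite -!scalemxAl -!scalemxAr scalerA !addrA; congr (_ + _).
  by rewrite -!addrA; congr (_ + _); rewrite addrC.
have := e 1; have := e (-1); have := e 'i; have := e (- 'i).
rewrite !(rmorphN, rmorph1, conjCi) /= !conjCi !scaleNr !scale1r => -> -> -> ->.
move: (x *m x^t*) (y *m x^t*) (x *m y^t*) (y *m y^t*) => X Y Z T.
have i2 : ('i : C) * 'i = -1 by rewrite -expr2 sqrCi.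
apply/matrixP => i j; rewrite !mxE; ring: i2.
Qed.

(** Elementary matrices are products [x y^*], which polarization reduces to the [v v^*]; linearity
    in [X] does the rest. *)
Lemma unitary_equivariant_lie X : lie_equivariant S X.
Proof.
have D (x y : 'cV[C]_d) : lie_equivariant S (x *m y^t* : 'M[C]_d).
  have -> : x *m y^t* = 4^-1 *: (4 *: (x *m y^t*)).
    by rewrite scalerA mulVf ?scale1r// pnatr_eq0.
  apply: lie_equivariantZ; rewrite polarization.
  have r1 := unitary_equivariant_rank1; have rZ c v := lie_equivariantZ c (r1 v).
  exact: lie_equivariantB (lie_equivariantD (lie_equivariantB (r1 _) (r1 _))
    (rZ _ _)) (rZ _ _).
have K0 : lie_equivariant S 0.
  by move=> B; rewrite /lie !(mul0mx, mulmx0) subr0 linear0.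
have KD := @lie_equivariantD S.
rewrite [X]matrix_sum_delta.
elim/big_ind: _ => [||i _]; [exact: K0|exact: KD|].
elim/big_ind: _ => [||j _]; [exact: K0|exact: KD|].
apply: lie_equivariantZ.
have -> : delta_mx i j = delta_mx i 0 *m (delta_mx j 0 : 'cV[C]_d)^t*.
  by rewrite trmx_delta map_delta_mx mul_delta_mx.
exact: D.
Qed.

End UnitaryEquivariant.
End Commutant.

Section LieEquivariant.
Variables (C : numClosedFieldType) (d : nat).
Implicit Types (A X Y : 'M[C]_d) (S : 'End('M[C]_d)).
Local Notation E i j := (delta_mx i j : 'M[C]_d).

Lemma lie_deltaE i j Y k l :
  lie (E i j) Y k l = Y j l *+ (k == i) - Y k i *+ (l == j).
Proof.
rewrite lieE !mxE (bigD1 j)//= big1 => [|h /negPf hj]; last first.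
  by rewrite mxE hj andbF mul0r.
rewrite [X in _ - X](bigD1 i)//= big1 => [|h /negPf hi]; last first.
  by rewrite mxE hi mulr0.
by rewrite !addr0 !mxE !eqxx andbT /= mulr_natl mulr_natr.
Qed.

Lemma lie_delta i j k l :
  lie (E i j) (E k l) = E i l *+ (j == k) - E k j *+ (l == i).
Proof. by rewrite /lie !mul_delta_mx_cond. Qed.

(* Commuting with [ad (E i i)] makes [S] preserve weight spaces; commuting with
   [ad (E k l)] on [S (E j j)] then shows that the factor by which [S] scales
   [E k j] and [E j k] is [y j j - y j k], which does not depend on [k]. *)
Lemma lie_equivariant_scalar S : (1 < d)%N -> (forall X, lie_equivariant S X) ->
  exists a b : C, forall A, S A = a *: A + (b * \tr A)%:M.
Proof.
move=> d1 SX.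
have SMn B n k l : S (B *+ n) k l = S B k l *+ n by rewrite raddfMn mulmxnE.
have SB A B k l : S (A - B) k l = S A k l - S B k l by rewrite raddfB !mxE.
have eqv i j k l m n : S (lie (E i j) (E k l)) m n =
    S (E k l) j n *+ (m == i) - S (E k l) m i *+ (n == j).
  by rewrite SX lie_deltaE.
have offE i j k l : i != j -> (k, l) != (i, j) -> S (E i j) k l = 0.
  move=> ij; rewrite xpair_eqE negb_and => kl.
  have ki : k != i -> S (E i j) k l = 0.
    move=> ki; have := eqv i i i j k l.
    rewrite lie_delta eqxx (negPf ki) eq_sym (negPf ij) subr0 mulr1n sub0r.
    (* For [l = i] the relation says that the entry is its own opposite, hence zero in
       characteristic zero. *)
    case: eqP => [->|_]; last by rewrite mulr0n oppr0.
    by rewrite mulr1n => /eqP; rewrite -addr_eq0 -mulr2n mulrn_eq0 => /eqP.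
  case: (eqVneq k i) kl ki => [-> /= lj _|ki _ -> //].
  have := eqv j j i j i l.
  rewrite lie_delta (eq_sym j) eqxx (negPf ij) (negPf lj) sub0r mulr0n mulr0n.
  by rewrite mulr1n linearN mxE subr0 => /eqP; rewrite oppr_eq0 => /eqP.
pose y j k := S (E j j) k k.
have diagE j k l : k != l -> S (E j j) k l = 0.
  move=> kl; have := eqv k k j j k l.
  rewrite lie_delta eqxx (eq_sym l) (negPf kl) subr0 mulr1n => <-.
  by rewrite (eq_sym k); case: eqP => [->|_]; rewrite subrr linear0 mxE.
have yE j k l : k != l ->
    y j l - y j k = S (E k l) k l *+ (l == j) - S (E j l) k l *+ (j == k).
  move=> kl; have := eqv k l j j k l; rewrite lie_delta !eqxx !mulr1n => <-.
  rewrite SB !SMn; congr (_ - _).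
  by case: eqP => [->|].
(* An index different from [j], here [1] or [0]; it exists because [1 < d]. *)
pose o : 'I_d -> 'I_d := fun j =>
  if val j == 0%N then Ordinal d1 else Ordinal (ltnW d1).
have oj j : o j != j.
  rewrite /o; case: (eqVneq (val j) 0%N) => [j0|j0]; rewrite -val_eqE /= ?j0//.
  by rewrite eq_sym.
pose a j := y j j - y j (o j).
have yy j k l : k != j -> l != j -> y j k = y j l.
  move=> kj lj; case: (eqVneq k l) => [-> //|kl].
  have /eqP := yE j k l kl; rewrite (negPf lj) (eq_sym j) (negPf kj) subrr.
  by rewrite subr_eq0 => /eqP.
have aj j k : k != j -> S (E k j) k j = a j.
  move=> kj; have := yE j k j kj; rewrite eqxx (eq_sym j) (negPf kj) subr0 mulr1n => <-.
  by rewrite /a (yy j k (o j)).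
have aj' j k : k != j -> S (E j k) j k = a j.
  move=> kj; have := yE j j k; rewrite eq_sym kj eqxx (negPf kj) => /(_ isT).
  rewrite sub0r mulr1n => /eqP; rewrite -eqr_oppLR opprB => /eqP <-.
  by rewrite /a (yy j k (o j)).
(* The entry of [S (E j k)] at [j k] is [a j] by [aj'] and [a k] by [aj]. *)
have aa j k : a j = a k.
  case: (eqVneq k j) => [-> //|kj]; by rewrite -(aj' j k) // (aj k j) // eq_sym.
pose b j := y j (o j).
have bb j k : b j = b k.
  case: (eqVneq k j) => [-> //|kj].
  (* The commutator of [E j k] and [E k j] is [E j j - E k k]; its image has entry [a j] at [j j],
     which compares [b j] with [b k]. *)
  have := eqv j k k j j j; rewrite lie_delta !eqxx !mulr1n SB.
  rewrite (eq_sym j) (negPf kj) subr0 => e1.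
  have e2 : S (E j j) j j - S (E k k) j j = a j by rewrite e1 aj.
  have : S (E k k) j j = b k by apply: yy => //; rewrite eq_sym.
  by move: e2; rewrite /a /b /y => + e3; rewrite e3 => /subrI.
pose i0 : 'I_d := Ordinal d1.
have SE i j : S (E i j) = a i0 *: E i j + (b i0 *+ (i == j))%:M.
  apply/matrixP => k l; rewrite !mxE.
  case: (eqVneq i j) => [<-|ij].
    case: (eqVneq k l) => [<-|kl]; last first.
      rewrite diagE // mulr0n addr0; case: eqP => [ki|]; last by rewrite mulr0.
      by rewrite -ki (eq_sym l) (negPf kl) mulr0.
    rewrite andbb !mulr1n; case: eqVneq => [->|ki]; rewrite ?mulr1 ?mulr0 ?add0r.
      by rewrite -(aa i) -(bb i) subrK.
    by rewrite -(bb i); apply: yy.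
  rewrite mul0rn addr0; case: (eqVneq (k, l) (i, j)) => [[-> ->]|kl].
    by rewrite !eqxx mulr1 aj// (aa j i0).
  by rewrite offE//; move: kl; rewrite xpair_eqE => /negPf ->; rewrite mulr0.
exists (a i0), (b i0) => A.
rewrite {1}[A]matrix_sum_delta linear_sum /=.
under eq_bigr => i _.
  rewrite linear_sum /=; under eq_bigr => j _ do rewrite linearZ /= SE scalerDr.
  rewrite big_split /=; over.
rewrite big_split /=; congr (_ + _).
  rewrite [A in RHS]matrix_sum_delta scaler_sumr; apply: eq_bigr => i _.
  by rewrite scaler_sumr; apply: eq_bigr => j _; rewrite !scalerA mulrC.
rewrite mulr_sumr raddf_sum; apply: eq_bigr => i _ /=.
rewrite (bigD1 i)//= big1 => [|j /negPf ji]; last first.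
  by rewrite eq_sym ji mulr0n raddf0 scaler0.
by rewrite eqxx addr0 mulr1n scale_scalar_mx mulrC.
Qed.

End LieEquivariant.

(** * Nondefective eigenvalues *)

Lemma char_poly_conj (F : fieldType) n (S M : 'M[F]_n) :
  S \in unitmx -> char_poly (S *m M *m invmx S) = char_poly M.
Proof.
move=> Su; rewrite /char_poly.
have -> : char_poly_mx (S *m M *m invmx S) =
    map_mx polyC S *m char_poly_mx M *m map_mx polyC (invmx S).
  rewrite /char_poly_mx mulmxBr mulmxBl !map_mxM /=; congr (_ - _).
  by rewrite scalar_mxC -mulmxA -map_mxM mulmxV// map_mx1 mulmx1.
by rewrite !det_mulmx mulrAC -det_mulmx -map_mxM mulmxV// map_mx1 det1 mul1r.
Qed.

Lemma char_poly_lblock (F : fieldType) k m (J : 'M[F]_k)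
    (X : 'M[F]_(m, k)) (Y : 'M[F]_m) :
  char_poly (block_mx J 0 X Y) = char_poly J * char_poly Y.
Proof.
rewrite /char_poly /char_poly_mx scalar_mx_block map_block_mx map_mx0.
by rewrite opp_block_mx add_block_mx subr0 det_lblock.
Qed.

(** Completing the rows of [V] to a basis makes [M] block lower triangular with [J] in the
    corner. *)
Lemma char_poly_stable_dvd (F : fieldType) k n (M : 'M[F]_n) (V : 'M[F]_(k, n)) J :
  row_free V -> V *m M = J *m V -> char_poly J %| char_poly M.
Proof.
move=> Vf VM; have kn : (k <= n)%N by rewrite -(eqP Vf) rank_leq_col.
move: kn M V Vf VM => /subnKC; move: (n - k)%N => m <- M V Vf VM.
(* The last [m] rows of the extended row basis supplement those of [V]. *)
pose D := dsubmx (row_ebase V); pose S := col_mx V D.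
have SE : S = block_mx (col_ebase V) 0 0 1%:M *m row_ebase V.
  rewrite -[row_ebase V in RHS]vsubmxK mul_block_col !mul0mx mul1mx addr0 add0r.
  congr col_mx; rewrite -[LHS]mulmx_ebase (eqP Vf).
  rewrite -[row_ebase V in LHS]vsubmxK -mulmxA pid_mx_row.
  by rewrite mul_row_col mul1mx mul0mx addr0.
have Su : S \in unitmx.
  rewrite SE unitmx_mul row_ebase_unit andbT unitmxE det_lblock det1 mulr1.
  by rewrite -unitmxE col_ebase_unit.
pose Z := D *m M *m invmx S.
rewrite -(char_poly_conj M Su).
have -> : S *m M *m invmx S = block_mx J 0 (lsubmx Z) (rsubmx Z).
  apply: (can_inj (mulmxK Su)); rewrite mulmxKV// mul_col_mx VM.
  rewrite -[RHS]/(_ *m col_mx V D) mul_block_col mul0mx addr0; congr col_mx.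
  by rewrite -mul_row_col hsubmxK mulmxKV.
by rewrite char_poly_lblock dvdp_mulr.
Qed.

(** An eigenvalue [b] satisfies [(b - a) ^ 2 = 0], so [a] is the only root, and the degree fixes its
    multiplicity. *)
Lemma char_poly_nilp (F : closedFieldType) k (J : 'M[F]_k) a :
  (J - a%:M) *m (J - a%:M) = 0 -> char_poly J = ('X - a%:P) ^+ k.
Proof.
move=> J2; have [s sE] := closed_field_poly_normal (char_poly J).
rewrite (monicP (char_poly_monic J)) scale1r in sE.
have sa : all (pred1 a) s.
  apply/allP => b bs.
  have /eigenvalueP[v vJ v0] : eigenvalue J b.
    by rewrite eigenvalue_root_char sE root_prod_XsubC.
  have vJa : v *m (J - a%:M) = (b - a) *: v.
    by rewrite mulmxBr vJ mul_mx_scalar scalerBl.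
  have : v *m ((J - a%:M) *m (J - a%:M)) = 0 by rewrite J2 mulmx0.
  rewrite mulmxA vJa -scalemxAl vJa scalerA => /eqP.
  by rewrite scaler_eq0 (negPf v0) orbF mulf_eq0 orbb subr_eq0.
have sk : size s = k.
  by apply/eqP; rewrite -eqSS -(size_prod_XsubC s id) -sE size_char_poly.
by rewrite sE (all_pred1P _ _ sa) big_nseq sk -Monoid.iteropE.
Qed.

(* [M] acts on the kernel of [(M - a)^2] with characteristic polynomial a power
   of ['X - a], so the multiplicity of [a] bounds the dimension of that kernel. *)
Lemma nondefective_ker_sqr (C : closedFieldType) n (M : 'M[C]_n) a :
  (mup a (char_poly M) <= \rank (eigenspace M a))%N ->
  (kermx ((M - a%:M) *m (M - a%:M)) <= eigenspace M a)%MS.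
Proof.
pose N := M - a%:M; pose V := row_base (kermx (N *m N)); rewrite -/N => nd.
have NM : M *m N = N *m M by rewrite /N mulmxBr mulmxBl scalar_mxC.
have VNN : V *m (N *m N) = 0 by apply/sub_kermxP; rewrite eq_row_base.
have /submxP[J VM] : (V *m M <= V)%MS.
  rewrite eq_row_base; apply/sub_kermxP.
  by rewrite -mulmxA (mulmxA M) NM -mulmxA NM !mulmxA -(mulmxA V) VNN mul0mx.
have Vf : row_free V by apply: row_base_free.
have VN : (J - a%:M) *m V = V *m N.
  by rewrite (mulmxBl J) -VM mul_scalar_mx (mulmxBr V M) mul_mx_scalar.
have J2 : (J - a%:M) *m (J - a%:M) = 0.
  by apply: (row_free_inj Vf); rewrite mul0mx -mulmxA VN mulmxA VN -mulmxA.
have := char_poly_stable_dvd Vf VM; rewrite (char_poly_nilp J2).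
rewrite -mup_geq ?monic_neq0 ?char_poly_monic// => /leq_trans /(_ nd) le2.
have kk : (kermx N <= kermx (N *m N))%MS.
  by apply/sub_kermxP; rewrite mulmxA mulmx_ker mul0mx.
by rewrite -(mxrank_leqif_sup kk) eqn_leq mxrankS.
Qed.

(** If a left eigenvector [z] were orthogonal to all right ones, it would be [y (M - a)] for some
    [y]; then [y] is killed by the square of [M - a], hence by [M - a] itself, and [z = 0]. *)
Lemma nondefective_eigenpair (C : numClosedFieldType) n (M : 'M[C]_n) a :
  eigenvalue M a -> nondefective M a ->
  exists z : 'rV[C]_n, exists w : 'cV[C]_n,
    [/\ z *m M = a *: z, M *m w = a *: w & z *m w = 1%:M].
Proof.
move=> Ma nd; pose N := M - a%:M.
have ker2 : (kermx (N *m N) <= kermx N)%MS.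
  by apply: nondefective_ker_sqr; rewrite nd.
have /eigenvalueP[z zM z0] := Ma.
have zN : z *m N = 0 by rewrite mulmxBr zM mul_mx_scalar subrr.
have : ~~ (z <= N)%MS.
  apply/negP => /submxP[y zE].
  have : (y <= kermx (N *m N))%MS by apply/sub_kermxP; rewrite mulmxA -zE.
  move=> /submx_trans /(_ ker2) /sub_kermxP yN.
  by rewrite zE yN eqxx in z0.
rewrite submxE => /matrix0Pn [i [j zj]].
(* The columns of [cokermx N] span the right kernel of [N]; this one pairs with [z] to a nonzero
   value. *)
pose w : 'cV_n := cokermx N *m delta_mx j 0.
exists z, (((z *m w) 0 0)^-1 *: w); split=> //.
  have Nw : N *m w = 0 by rewrite /w mulmxA mulmx_coker mul0mx.
  have := mulmxBl M a%:M w; rewrite -/N Nw mul_scalar_mx => /esym/subr0_eq Mw.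
  by rewrite -scalemxAr Mw !scalerA mulrC.
rewrite -scalemxAr {2}[z *m w]mx11_scalar scale_scalar_mx mulVf//.
by rewrite /w mulmxA -colE mxE -[0](ord1 i).
Qed.

(** * Matrices of linear maps in a Hermitian basis *)

Section Expect.
Variables (C : numClosedFieldType) (X : finType).

Lemma expect_linear (V W : lmodType C) (phi : {linear V -> W}) (f : X -> V) :
  phi (expect f) = expect (fun x => phi (f x)).
Proof. by rewrite /expect linearZ linear_sum. Qed.

Lemma eq_expect (V : lmodType C) (f g : X -> V) :
  f =1 g -> expect f = expect g.
Proof. by move=> fg; rewrite /expect (eq_bigr _ (fun x _ => fg x)). Qed.

Lemma expectZ (V : lmodType C) c (f : X -> V) :
  expect (fun x => c *: f x) = c *: expect f.
Proof. by rewrite /expect -scaler_sumr !scalerA mulrC. Qed.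

Lemma expectD (V : lmodType C) (f g : X -> V) :
  expect (fun x => f x + g x) = expect f + expect g.
Proof. by rewrite /expect big_split scalerDr. Qed.

(** [x0] makes [X] nonempty; over an empty type the average is [0]. *)
Lemma expect_const (V : lmodType C) (v : V) (x0 : X) : expect (fun _ : X => v) = v.
Proof.
rewrite /expect sumr_const -[v *+ _]scaler_nat scalerA mulVf ?scale1r// pnatr_eq0.
by rewrite -lt0n; apply/card_gt0P; exists x0.
Qed.

Lemma expect_lfunE (V W : vectType C) (f : X -> 'Hom(V, W)) v :
  expect f v = expect (fun x => f x v).
Proof. by rewrite /expect scale_lfunE sum_lfunE. Qed.

Lemma mulmx_expectr n k l (Y : 'M[C]_(n, k)) (f : X -> 'M[C]_(k, l)) :
  Y *m expect f = expect (fun x => Y *m f x).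
Proof. exact: (expect_linear (mulmx Y)). Qed.

Lemma mulmx_expectl n k l (f : X -> 'M[C]_(n, k)) (Y : 'M[C]_(k, l)) :
  expect f *m Y = expect (fun x => f x *m Y).
Proof. exact: (expect_linear (mulmxr Y)). Qed.

Lemma mxtrace_expect n (f : X -> 'M[C]_n) :
  \tr (expect f) = expect (fun x => \tr (f x) : C^o).
Proof. exact: (expect_linear (@mxtrace C n)). Qed.

End Expect.

Section Basis.
Variables (C : numClosedFieldType) (d : nat) (B : 'I_(d ^ 2) -> 'M[C]_d).
Hypothesis B_basis : hermitian_basis B.
Implicit Types (f g : 'End('M[C]_d)) (A : 'M[C]_d).
Local Notation m := (matrix_of B).

Lemma mxtrace_adjmul n k (X Y : 'M[C]_(n, k)) :
  \tr (X^t* *m Y) = (mxvec Y *m (mxvec X)^t*) 0 0.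
Proof.
rewrite mxE /mxtrace (reindex _ (curry_mxvec_bij n k)) /=.
transitivity (\sum_i \sum_j Y i j * (X i j)^*).
  rewrite exchange_big /=; apply: eq_bigr => j _; rewrite mxE.
  by apply: eq_bigr => i _; rewrite !mxE mulrC.
by rewrite pair_bigA; apply: eq_bigr => -[i j] _ /=; rewrite !mxE !mxvecE.
Qed.

Lemma hermitian_basis_adj j : (B j)^t* = B j.
Proof.
have [Bh _ _] := B_basis.
by have := Bh j; rewrite is_hermitianmxE expr0 scale1r => /eqP <-.
Qed.

(** Orthonormality says [P P^* = 1] for the matrix of vectorized basis elements. As [P] is square,
    [P^* P = 1] follows, which is completeness. *)
Lemma hermitian_basis_sum A : A = \sum_j \tr ((B j)^t* *m A) *: B j.
Proof.
pose P : 'M[C]_(d * d) := \matrix_j mxvec (B j).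
have PP : P *m P^t* = 1%:M.
  apply/matrixP => j k; have [_ + _] := B_basis => /(_ k j).
  rewrite mxtrace_adjmul mxE => e; rewrite [RHS]mxE eq_sym -e !mxE.
  by apply: eq_bigr => x _; rewrite !mxE.
apply: (can_inj mxvecK); rewrite -[LHS]mulmx1 -(mulmx1C PP) mulmxA.
rewrite mulmx_sum_row linear_sum; apply: eq_bigr => j _ /=.
rewrite rowK linearZ /=; congr (_ *: _).
rewrite mxtrace_adjmul !mxE; by apply: eq_bigr => x _; rewrite !mxE.
Qed.

Lemma matrix_of_linear : linear (matrix_of B).
Proof.
move=> a f g; apply/matrixP => j k; rewrite !mxE add_lfunE scale_lfunE.
by rewrite mulmxDr -scalemxAr linearD linearZ.
Qed.
HB.instance Definition _ := GRing.isLinear.Build C _ _ _ (matrix_of B) matrix_of_linear.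

Lemma matrix_ofB f g : m (f - g) = m f - m g.
Proof. exact: (linearB (matrix_of B)). Qed.

Lemma matrix_ofD f g : m (f + g) = m f + m g.
Proof. exact: (linearD (matrix_of B)). Qed.

Lemma matrix_ofZ c f : m (c *: f) = c *: m f.
Proof. by rewrite linearZ. Qed.

Lemma matrix_ofM f g : m (f \o g)%VF = m f *m m g.
Proof.
apply/matrixP => j k; rewrite !mxE comp_lfunE {1}[g _]hermitian_basis_sum.
rewrite linear_sum mulmx_sumr linear_sum; apply: eq_bigr => l _ /=.
by rewrite linearZ /= -scalemxAr linearZ /= !mxE mulrC.
Qed.

Lemma matrix_of1 : m \1%VF = 1%:M.
Proof. by apply/matrixP => j k; rewrite !mxE id_lfunE; have [_ ->] := B_basis. Qed.

Lemma matrix_of_inj : injective (matrix_of B).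
Proof.
move=> f g fg; apply/lfunP => A; rewrite [A]hermitian_basis_sum !linear_sum.
apply: eq_bigr => k _; rewrite !linearZ /=; congr (_ *: _).
rewrite [LHS]hermitian_basis_sum [RHS]hermitian_basis_sum.
apply: eq_bigr => j _; congr (_ *: _).
by have /matrixP/(_ j k) := fg; rewrite !mxE.
Qed.

(** A preimage combines the rank-one maps [A |-> tr (B_k^* A) B_j] with coefficients [X j k]. *)
Lemma matrix_of_surj (X : 'M[C]_(d ^ 2)) : exists f, m f = X.
Proof.
pose phi A : 'M[C]_d := \sum_k \sum_j (X j k * \tr ((B k)^t* *m A)) *: B j.
have phiL : linear phi.
  move=> a A A'; rewrite /phi scaler_sumr -big_split; apply: eq_bigr => k _ /=.
  rewrite scaler_sumr -big_split; apply: eq_bigr => j _ /=.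
  rewrite scalerA -scalerDl mulmxDr -scalemxAr linearD linearZ /=; congr (_ *: _).
  by ring.
pose phil : {linear 'M[C]_d -> 'M[C]_d} :=
  HB.pack phi (GRing.isLinear.Build C _ _ _ phi phiL).
have [_ orth _] := B_basis.
exists (linfun phil); apply/matrixP => j k; rewrite mxE lfunE /= /phi.
rewrite mulmx_sumr linear_sum (bigD1 k)//= [X in _ + X]big1 => [|l /negPf lk].
  rewrite addr0 mulmx_sumr linear_sum (bigD1 j)//= [X in _ + X]big1 => [|i /negPf ij].
    by rewrite -scalemxAr linearZ /= !orth !eqxx !mulr1 addr0.
  by rewrite -scalemxAr linearZ /= !orth eq_sym ij mulr0.
rewrite big1 ?mulmx0 ?linear0// => i _.
by rewrite orth lk mulr0 scale0r.
Qed.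

(** A transpose without conjugation: the [B j] are Hermitian, so cyclicity of the trace exchanges
    [j] and [k]. *)
Lemma matrix_of_adj (V : 'M[C]_d) :
  m (unitary_channel_adj V) = (m (unitary_channel V))^T.
Proof.
apply/matrixP => j k; rewrite !mxE unitary_channel_adjE unitary_channelE.
rewrite !hermitian_basis_adj.
by rewrite !mulmxA mxtrace_mulC !mulmxA mxtrace_mulC !mulmxA.
Qed.

Lemma mxtrace_matrix_of_rank1 (X Y : 'M[C]_d) f :
  (forall A, f A = \tr (X *m A) *: Y) -> \tr (m f) = \tr (X *m Y).
Proof.
move=> fE; rewrite [Y in RHS]hermitian_basis_sum mulmx_sumr linear_sum /=.
apply: eq_bigr => j _.
by rewrite mxE fE -!scalemxAr !mxtraceZ mulrC.
Qed.

Lemma matrix_of_expect (X : finType) (f : X -> 'End('M[C]_d)) :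
  m (expect f) = expect (fun x => m (f x)).
Proof. exact: (expect_linear (matrix_of B)). Qed.

Lemma trace_projE (A : 'M[C]_d) : trace_proj C d A = (\tr A / d%:R)%:M.
Proof. by rewrite lfunE. Qed.

Lemma mxtrace_matrix_of_trace_proj :
  d%:R != 0 :> C -> \tr (m (trace_proj C d)) = 1.
Proof.
move=> d0; rewrite (@mxtrace_matrix_of_rank1 (d%:R^-1)%:M 1%:M) => [|A].
  by rewrite mulmx1 mxtrace_scalar -[_ *+ d]mulr_natr mulVf.
by rewrite trace_projE mul_scalar_mx mxtraceZ scale_scalar_mx mulr1 mulrC.
Qed.

End Basis.

(** * The twirl *)

Section Phase.
Variables (C : numClosedFieldType) (d : nat).
Implicit Types (f : 'End('M[C]_d)).

Lemma trmxC_scale n k (c : C) (V : 'M[C]_(n, k)) : (c *: V)^t* = c^* *: V^t*.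
Proof. by apply/matrixP => i j; rewrite !mxE rmorphM. Qed.

Lemma unitary_channel_phase (c : C) (V : 'M[C]_d) : `|c| = 1 ->
  unitary_channel (c *: V) = unitary_channel V.
Proof.
move=> c1; apply/lfunP => A; rewrite !unitary_channelE trmxC_scale.
by rewrite -!scalemxAl -scalemxAr scalerA -normCK c1 expr1n scale1r.
Qed.

Lemma conjugate_map_phase (c : C) (V : 'M[C]_d) f : `|c| = 1 ->
  conjugate_map (c *: V) f = conjugate_map V f.
Proof.
move=> c1; rewrite /conjugate_map unitary_channel_phase//.
by rewrite /unitary_channel_adj trmxC_scale unitary_channel_phase// norm_conjC.
Qed.

Lemma conjugate_map1 f : conjugate_map 1%:M f = f.
Proof.
apply/lfunP => A; rewrite !comp_lfunE unitary_channel_adjE unitary_channelE.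
by rewrite trmx1 map_mx1 !(mul1mx, mulmx1).
Qed.

Variables (gT : finGroupType) (U : gT -> 'M[C]_d).
Hypothesis U_group : unitary_group_mod_phase U.

Lemma unitary_group_inv g :
  exists2 c : C, `|c| = 1 & U g^-1%g = c *: (U g)^t*.
Proof.
have [Uu UM _] := U_group.
have uK h : (U h)^t* *m U h = 1%:M by apply/mulmx1C/unitarymxP.
have [c c1 e1] := UM 1%g 1%g; have [c' c1' eV] := UM g^-1%g g.
rewrite mulg1 in e1; rewrite mulVg in eV.
(* [U 1] is invertible and idempotent up to a phase, hence a phase multiple of the identity. *)
have U1 : c *: U 1%g = 1%:M.
  by rewrite -(uK 1%g) {3}e1 -scalemxAr mulmxA uK mul1mx.
have c0 : c * c' != 0 by rewrite mulf_neq0// -normr_eq0 ?c1 ?c1' oner_eq0.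
exists (c * c')^-1; first by rewrite normfV normrM c1 c1' mulr1 invr1.
rewrite -[(U g)^t*]mul1mx -U1 eV -!scalemxAl -mulmxA.
by rewrite (unitarymxP (Uu g)) mulmx1 !scalerA -mulrA mulVf// scale1r.
Qed.

(** Inversion permutes the group, and the phase relating [U g^-1] to the adjoint of [U g] cancels in
    a conjugation. *)
Lemma twirl_adj f : expect (fun g => conjugate_map ((U g)^t*) f) = twirl U f.
Proof.
rewrite /twirl /expect (reindex_inj invg_inj); congr (_ *: _).
apply: eq_bigr => g _; have [c c1 ->] := unitary_group_inv g.
by rewrite trmxC_scale conjugate_map_phase ?norm_conjC// trmxCK.
Qed.

End Phase.

Section TwirlTrace.
Variables (C : numClosedFieldType) (d : nat) (B : 'I_(d ^ 2) -> 'M[C]_d).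
Hypothesis B_basis : hermitian_basis B.
Variables (gT : finGroupType) (U : gT -> 'M[C]_d).
Hypothesis U_group : unitary_group_mod_phase U.
Implicit Types (f : 'End('M[C]_d)).
Local Notation m := (matrix_of B).

Lemma mxtrace_conjugate_map V f h :
  \tr (m f *m m (conjugate_map V h)) = \tr (m (conjugate_map (V^t*) f) *m m h).
Proof.
rewrite /conjugate_map /unitary_channel_adj trmxCK !matrix_ofM//.
by rewrite !mulmxA mxtrace_mulC !mulmxA.
Qed.

Lemma mxtrace_twirl f h :
  \tr (m f *m m (twirl U h)) = \tr (m (twirl U f) *m m h).
Proof.
rewrite -[twirl U f](twirl_adj U_group) /twirl !matrix_of_expect mulmx_expectr.
rewrite mulmx_expectl !mxtrace_expect; apply: eq_expect => g.
exact: mxtrace_conjugate_map.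
Qed.

(** Nondegeneracy of the trace form: every elementary matrix is the matrix of some map and picks out
    one entry. *)
Lemma mxtrace_matrix_of_mul_inj (X Y : 'M[C]_(d ^ 2)) :
  (forall f, \tr (m f *m X) = \tr (m f *m Y)) -> X = Y.
Proof.
move=> XY; apply/matrixP => i j.
have [f fE] := matrix_of_surj B_basis (delta_mx j i).
have tE (Z : 'M[C]_(d ^ 2)) : \tr (delta_mx j i *m Z) = Z i j.
  have -> : delta_mx j i *m Z = delta_mx j 0 *m row i Z.
    by rewrite rowE mulmxA mul_delta_mx.
  by rewrite mxtrace_mulC -colE trace_mx11 !mxE.
by have := XY f; rewrite fE !tE.
Qed.

(* The twirl is self-adjoint for the trace form, which turns invariance of its
   argument into invariance of its value. *)
Lemma twirl_conjugate_invariant :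
  (forall W f, W \is unitarymx -> twirl U (conjugate_map W f) = twirl U f) ->
  forall W f, W \is unitarymx -> conjugate_map W (twirl U f) = twirl U f.
Proof.
move=> TW W f Wu; apply: (matrix_of_inj B_basis); apply: mxtrace_matrix_of_mul_inj => h.
by rewrite mxtrace_conjugate_map !mxtrace_twirl TW// trmxC_unitary.
Qed.

(** Self-adjointness moves the twirl onto the identity map, which it fixes. *)
Lemma mxtrace_twirl1 f : \tr (m (twirl U f)) = \tr (m f).
Proof.
have := mxtrace_twirl \1%VF f; rewrite matrix_of1// !mul1mx => ->.
suff -> : twirl U \1%VF = \1%VF by rewrite matrix_of1// mul1mx.
rewrite /twirl -[RHS](expect_const _ (1%g : gT)); apply: eq_expect => g.
apply/lfunP => A; rewrite !comp_lfunE id_lfunE unitary_channel_adjE unitary_channelE.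
have [Uu _ _] := U_group; have := mulmx1C (unitarymxP (Uu g)) => UU.
by rewrite !mulmxA UU mul1mx -mulmxA UU mulmx1 id_lfunE.
Qed.

Lemma mxtrace_twirl_scalar f : \tr (twirl U f 1%:M) = \tr (f 1%:M).
Proof.
have [Uu _ _] := U_group.
rewrite /twirl expect_lfunE mxtrace_expect -[RHS](expect_const _ (1%g : gT)).
apply: eq_expect => g /=; rewrite !comp_lfunE unitary_channel_adjE unitary_channelE.
by rewrite mulmx1 (unitarymxP (Uu g)) mxtrace_mulC mulmxA (unitarymxP (Uu g)) mul1mx.
Qed.

End TwirlTrace.

(** The traces give [t = a + b d] and [t + (d^2 - 1) p = a d^2 + b d]; as [d^2 - 1] is nonzero, they
    force [p = a]. *)
Lemma depolarizing_of_traces (C : numClosedFieldType) (d : nat) (d_ge2 : (2 <= d)%N)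
    (B : 'I_(d ^ 2) -> 'M[C]_d) (B_basis : hermitian_basis B)
    (S : 'End('M[C]_d)) (a b p t : C) :
  (forall A, S A = a *: A + (b * \tr A)%:M) ->
  \tr (S 1%:M) = t * d%:R ->
  \tr (matrix_of B S) = t + (d ^ 2 - 1)%:R * p ->
  S = depolarizing d p t.
Proof.
move=> TE St Sp.
have d0 : d%:R != 0 :> C by rewrite pnatr_eq0 -lt0n ltnW.
have tE : t = a + b * d%:R.
  apply: (mulIf d0); rewrite -St TE.
  by rewrite mxtraceD mxtraceZ mxtrace1 mxtrace_scalar -[_ *+ d]mulr_natr; ring.
have pE : p = a.
  have : \tr (matrix_of B S) = a * (d ^ 2)%:R + b * d%:R.
    (* The part of [S] along the identity matrix is [b d] times a projection of trace one. *)
    have -> : S = a *: \1%VF + (b * d%:R) *: trace_proj C d.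
      apply/lfunP => A; rewrite add_lfunE !scale_lfunE id_lfunE lfunE /= TE.
      by rewrite /trace_part scale_scalar_mx -mulrA [d%:R * _]mulrC divfK.
    rewrite linearD !linearZ /= mxtraceD !mxtraceZ (matrix_of1 B_basis) mxtrace1.
    congr (_ + _); rewrite -[RHS]mulr1; congr (_ * _).
    exact: mxtrace_matrix_of_trace_proj.
  rewrite Sp tE => /eqP.
  rewrite natrB ?expn_gt0 ?(ltnW d_ge2)//.
  have d2 : (d ^ 2)%:R - 1 != 0 :> C.
    by rewrite subr_eq0 -[1]/(1%:R) eqr_nat -[1%N]/(1 ^ 2)%N eqn_exp2r// gtn_eqF.
  move=> /eqP e; apply: (mulfI d2).
  by apply: (addrI (a + b * d%:R)); rewrite e; ring.
apply/lfunP => A; rewrite TE depolarizingE pE tE.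
rewrite -{1}(divfK d0 (\tr A)); move: (\tr A / _) => c.
by apply/matrixP => i j; rewrite !mxE; case: (i == j); rewrite ?mulr1n ?mulr0n; ring.
Qed.

Lemma twirl_depolarizing (R : realType) (d : nat) (d_ge2 : (2 <= d)%N)
    (mu : probability (borel_mx R d) R) (mu_haar : haar_unitary mu)
    (gT : finGroupType) (U : gT -> 'M[Cplx R]_d)
    (U_group : unitary_group_mod_phase U) (U_2design : two_design mu U)
    (B : 'I_(d ^ 2) -> 'M[Cplx R]_d) (B_basis : hermitian_basis B)
    (p t : Cplx R) (f : 'End('M[Cplx R]_d)) :
  \tr (f 1%:M) = t * d%:R ->
  \tr (matrix_of B f) = t + (d ^ 2 - 1)%:R * p ->
  twirl U f = depolarizing d p t.
Proof.
move=> ft fp.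
have TW W h : W \is unitarymx -> twirl U (conjugate_map W h) = twirl U h.
  exact: (twirl_conjugate_map mu_haar U_2design).
have inv := twirl_conjugate_invariant B_basis U_group TW.
have SX : forall X, lie_equivariant (twirl U f) X.
  apply: unitary_equivariant_lie => W A Wu.
  (* Invariance under conjugation by the adjoint of [W], read at [W A W^*], is the required
     commutation. *)
  rewrite -{1}(inv (W^t*) f); last by rewrite trmxC_unitary.
  rewrite /conjugate_map !comp_lfunE unitary_channel_adjE unitary_channelE trmxCK.
  have WW := mulmx1C (unitarymxP Wu).
  congr (_ *m _ *m _); congr (twirl U f _).
  by rewrite !mulmxA WW mul1mx -mulmxA WW mulmx1.
have [a [b TE]] := lie_equivariant_scalar d_ge2 SX.
apply: (depolarizing_of_traces d_ge2 B_basis TE).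
  by rewrite (mxtrace_twirl_scalar U_group).
by rewrite (mxtrace_twirl1 B_basis U_group).
Qed.

(** * Construction of L and R *)

Section Reshape.
Variables (C : numClosedFieldType).

(* [mxtens_index (i, j)] is the row-major index of [*t], so the tensor factors act
   on the two sides of the reshaped vector. *)
Definition reshape_cV n k (w : 'cV[C]_(n * k)) : 'M[C]_(n, k) :=
  \matrix_(i, j) w (mxtens_index (i, j)) 0.

Lemma reshape_cV_is_linear n k : linear (@reshape_cV n k).
Proof. by move=> a v w; apply/matrixP => i j; rewrite !mxE. Qed.
HB.instance Definition _ n k := GRing.isLinear.Build C _ _ _
  (@reshape_cV n k) (@reshape_cV_is_linear n k).

Lemma sum_mxtens n k (F : 'I_(n * k) -> C) :
  \sum_x F x = \sum_i \sum_j F (mxtens_index (i, j)).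
Proof.
rewrite pair_bigA (reindex (@mxtens_index n k)) /=; last first.
  by exists (@mxtens_unindex n k) => x _; rewrite ?mxtens_indexK ?mxtens_unindexK.
by apply: eq_bigr => -[i j].
Qed.

Lemma reshape_cV_tens n k (X : 'M[C]_n) (Y : 'M[C]_k) w :
  reshape_cV ((X *t Y) *m w) = X *m reshape_cV w *m Y^T.
Proof.
apply/matrixP => i j; rewrite !mxE sum_mxtens exchange_big /=.
apply: eq_bigr => b _; rewrite !mxE mulr_suml; apply: eq_bigr => a _.
by rewrite tensmxE !mxE mulrAC.
Qed.

(** The pairing is bilinear, without conjugation, so the normalization of the eigenvectors becomes a
    trace. *)
Lemma mul_reshape_cV n k (z : 'rV[C]_(n * k)) (w : 'cV[C]_(n * k)) :
  (z *m w) 0 0 = \tr (reshape_cV z^T *m (reshape_cV w)^T).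
Proof.
rewrite mxE sum_mxtens; apply: eq_bigr => i _; rewrite mxE.
by apply: eq_bigr => j _; rewrite !mxE.
Qed.

(** Reshaping turns the two eigenvector equations of the averaged tensor product into the two
    intertwining relations. *)
Lemma tensor_mean_eigenpair (X : finType) n (G H : X -> 'M[C]_n) (Q : 'M[C]_n) p :
  let M := expect (fun g => (G g *m Q) *t H g) in
  Q^T = Q -> Q *m Q = Q -> (forall g, Q *m G g = G g *m Q) ->
  p != 0 -> eigenvalue M p -> nondefective M p ->
  exists L Rr : 'M[C]_n,
    [/\ expect (fun g => H g *m L *m (G g)^T) = p *: L,
        expect (fun g => (G g)^T *m Rr *m H g) = p *: Rr,
        L *m Q = L, Q *m Rr = Rr & \tr (Rr *m L) = 1].
Proof.
move=> M QT QQ QG p0 Mp nd.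
have [z [w [zM Mw zw]]] := nondefective_eigenpair Mp nd.
have QGT g : Q *m (G g)^T = (G g)^T *m Q.
  by rewrite -[in LHS]QT -trmx_mul -QG trmx_mul QT.
pose W := reshape_cV w; pose Z := reshape_cV z^T.
have MW : expect (fun g => G g *m Q *m W *m (H g)^T) = p *: W.
  rewrite -[RHS]linearZ /= -Mw mulmx_expectl (expect_linear (@reshape_cV n n)).
  by apply: eq_expect => g /=; rewrite reshape_cV_tens.
have MZ : expect (fun g => Q *m (G g)^T *m Z *m H g) = p *: Z.
  rewrite -[RHS]linearZ /= -linearZ /= -zM trmx_mul.
  have -> : M^T = expect (fun g => (G g *m Q)^T *t (H g)^T).
    rewrite (expect_linear (@trmx C (n * n) (n * n))); apply: eq_expect => g /=.
    exact: trmx_tens.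
  rewrite mulmx_expectl (expect_linear (@reshape_cV n n)).
  by apply: eq_expect => g /=; rewrite reshape_cV_tens trmxK trmx_mul QT.
(* The average in [MW] is fixed by [Q] on the left; dividing by the nonzero [p] gives the same for
   [W]. *)
have QW : Q *m W = W.
  apply: (scalerI p0); rewrite scalemxAr -MW mulmx_expectr; apply: eq_expect => g.
  by rewrite !mulmxA QG -[G g *m Q *m Q]mulmxA QQ.
have QZ : Q *m Z = Z.
  apply: (scalerI p0); rewrite scalemxAr -MZ mulmx_expectr; apply: eq_expect => g.
  by rewrite !mulmxA QQ.
(* As second tensor factor, [H] acts on the right of [W]; transposing brings it to the left. *)
exists W^T, Z; split => //.
- rewrite -[RHS]linearZ /= -MW (expect_linear (@trmx C n n)).
  by apply: eq_expect => g /=; rewrite -[G g *m Q *m W]mulmxA QW !trmx_mul trmxK mulmxA.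
- by rewrite -[RHS]MZ; apply: eq_expect => g; rewrite QGT -[_ *m Q *m Z]mulmxA QZ.
- by rewrite -[in LHS]QT -trmx_mul QW.
- by rewrite -mul_reshape_cV zw mxE eqxx.
Qed.

End Reshape.

(** * The projections onto multiples of the identity and onto traceless matrices *)

Section Depolarizing.
Variables (C : numClosedFieldType) (d : nat).
Hypothesis d0 : d%:R != 0 :> C.
Variable B : 'I_(d ^ 2) -> 'M[C]_d.
Hypothesis B_basis : hermitian_basis B.
Local Notation m := (matrix_of B).
Local Notation P := (m (trace_proj C d)).
Local Notation Q := (m (traceless_proj C d)).

Lemma unitary_trace_proj V : V \is unitarymx ->
  (unitary_channel V \o trace_proj C d)%VF = trace_proj C d.
Proof.
move=> Vu; apply/lfunP => A; rewrite comp_lfunE trace_projE unitary_channelE.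
by rewrite mul_mx_scalar -scalemxAl (unitarymxP Vu) scalemx1.
Qed.

Lemma trace_proj_unitary V : V \is unitarymx ->
  (trace_proj C d \o unitary_channel V)%VF = trace_proj C d.
Proof.
move=> Vu; apply/lfunP => A; rewrite comp_lfunE !trace_projE unitary_channelE.
by rewrite mxtrace_mulC mulmxA (mulmx1C (unitarymxP Vu)) mul1mx.
Qed.

Lemma matrix_of_traceless : Q = 1%:M - P.
Proof.
rewrite -(matrix_of1 B_basis).
exact: (matrix_ofB B \1%VF (trace_proj C d)).
Qed.

(** In coordinates, [x] is the functional [tr / d] and [y] the identity matrix; [x y] is the trace
    of the projection. *)
Lemma matrix_of_trace_proj_rank1 :
  exists x : 'rV[C]_(d ^ 2), exists y : 'cV[C]_(d ^ 2), P = y *m x /\ x *m y = 1%:M.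
Proof.
pose x : 'rV[C]_(d ^ 2) := \row_k (\tr (B k) / d%:R).
pose y : 'cV[C]_(d ^ 2) := \col_j \tr ((B j)^t*).
have PE : P = y *m x.
  apply/matrixP => j k; rewrite !mxE big_ord1 !mxE trace_projE.
  by rewrite mul_mx_scalar mxtraceZ mulrC.
exists x, y; split=> //; rewrite [LHS]mx11_scalar -trace_mx11 mxtrace_mulC -PE.
by rewrite mxtrace_matrix_of_trace_proj.
Qed.

Lemma matrix_of_trace_proj_sym : P^T = P.
Proof.
apply/matrixP => j k; rewrite !mxE !trace_projE !mul_mx_scalar !mxtraceZ.
rewrite !hermitian_basis_adj//.
by rewrite mulrAC [RHS]mulrAC (mulrC (\tr (B j))).
Qed.

(** Composing [f] with the projection gives the rank-one map [A |-> (tr A / d) f 1]. *)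
Lemma mxtrace_mul_trace_proj (f : 'End('M[C]_d)) : \tr (f 1%:M) = \tr (m f *m P) * d%:R.
Proof.
rewrite -matrix_ofM//.
rewrite (@mxtrace_matrix_of_rank1 _ _ _ B_basis (d%:R^-1)%:M (f 1%:M)) => [|A].
  by rewrite mul_scalar_mx mxtraceZ mulrC mulrA mulfV// mul1r.
by rewrite comp_lfunE trace_projE -scalemx1 linearZ /= mul_scalar_mx mxtraceZ mulrC.
Qed.

End Depolarizing.

Section Assembly.
Variables (C : numClosedFieldType) (d : nat).
Hypothesis d_ge2 : (2 <= d)%N.
Variable B : 'I_(d ^ 2) -> 'M[C]_d.
Hypothesis B_basis : hermitian_basis B.
Variables (gT : finGroupType) (U : gT -> 'M[C]_d).
Hypothesis U_unitary : forall g, U g \is unitarymx.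
Variable Gt : gT -> 'End('M[C]_d).
Local Notation m := (matrix_of B).
Local Notation P := (m (trace_proj C d)).
Local Notation Q := (m (traceless_proj C d)).
Local Notation G g := (m (unitary_channel (U g))).
Local Notation H g := (m (Gt g)).
Local Notation Mt := (m (expect Gt)).
Local Notation Mp := (expect (fun g => m (unitary_channel_u (U g)) *t H g)).

(** For nonzero [t], [L] sends the identity direction to a right eigenvector, and [Rr] is a left
    eigenvector as a functional with values along the identity, scaled by [t] to fix the trace. For
    [t = 0] zero maps do. *)
Lemma trivial_block (t : C) : eigenvalue Mt t -> (t != 0 -> nondefective Mt t) ->
  exists L Rr : 'M[C]_(d ^ 2),
    [/\ Mt *m L = t *: L, Rr *m Mt = t *: Rr, L *m P = L, P *m Rr = Rr
      & \tr (Rr *m L) = t].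
Proof.
move=> Mt_t nd; have [t0|t0] := eqVneq t 0.
  by exists 0, 0; rewrite !(mulmx0, mul0mx, scaler0) mxtrace0 t0.
have [z [w [zM Mw zw]]] := nondefective_eigenpair Mt_t (nd t0).
have d0 : d%:R != 0 :> C by rewrite pnatr_eq0 -lt0n ltnW.
have [x [y [PE xy]]] := matrix_of_trace_proj_rank1 d0 B_basis.
exists (w *m x), (t *: (y *m z)); split.
- by rewrite mulmxA Mw scalemxAl.
- by rewrite -!scalemxAl -mulmxA zM -scalemxAr.
- by rewrite PE -mulmxA (mulmxA x) xy mul1mx.
- by rewrite PE -scalemxAr -mulmxA (mulmxA x) xy mul1mx.
- rewrite -scalemxAl -mulmxA (mulmxA z) zw mul1mx mxtraceZ mxtrace_mulC xy.
  by rewrite mxtrace1 mulr1.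
Qed.

Lemma traceless_block (p : C) : eigenvalue Mp p -> (p != 0 -> nondefective Mp p) ->
  exists L Rr : 'M[C]_(d ^ 2),
    [/\ expect (fun g => H g *m L *m (G g)^T) = p *: L,
        expect (fun g => (G g)^T *m Rr *m H g) = p *: Rr,
        L *m P = 0, P *m Rr = 0 & \tr (Rr *m L) = (d ^ 2 - 1)%:R * p].
Proof.
move=> Mp_p nd; have [p0|p0] := eqVneq p 0.
  exists 0, 0; rewrite !(mulmx0, mul0mx, scaler0) mxtrace0 p0 mulr0; split=> //;
  rewrite -[RHS](expect_const _ (1%g : gT)); apply: eq_expect => g;
  by rewrite !(mulmx0, mul0mx).
have d0 : d%:R != 0 :> C by rewrite pnatr_eq0 -lt0n ltnW.
have QE := matrix_of_traceless B_basis.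
have PP : P *m P = P.
  have [x [y [-> xy]]] := matrix_of_trace_proj_rank1 d0 B_basis.
  by rewrite -mulmxA (mulmxA x) xy mul1mx.
have GP g : G g *m P = P by rewrite -matrix_ofM// unitary_trace_proj.
have PG g : P *m G g = P by rewrite -matrix_ofM// trace_proj_unitary.
have MpE : Mp = expect (fun g => (G g *m Q) *t H g).
  by apply: eq_expect => g; rewrite /unitary_channel_u matrix_ofM.
rewrite MpE in Mp_p nd.
have QT : Q^T = Q.
  by rewrite QE linearB /= trmx1 matrix_of_trace_proj_sym.
have QQ : Q *m Q = Q.
  by rewrite QE mulmxBl mul1mx mulmxBr mulmx1 PP subrr subr0.
have QG g : Q *m G g = G g *m Q.
  by rewrite QE mulmxBl mul1mx mulmxBr mulmx1 PG GP.
have [L [Rr [HL RH LQ QR trRL]]] :=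
  tensor_mean_eigenpair QT QQ QG p0 Mp_p (nd p0).
(* The pair comes normalized to trace one; the factor is the trace of [p Q]. *)
exists L, (((d ^ 2 - 1)%:R * p) *: Rr); split => //.
- under eq_expect => g do rewrite -scalemxAr -scalemxAl.
  by rewrite expectZ RH !scalerA mulrC.
- move: LQ; rewrite QE mulmxBr mulmx1 => /eqP.
  by rewrite -subr_eq0 addrAC subrr sub0r oppr_eq0 => /eqP.
- move: QR; rewrite QE mulmxBl mul1mx => /eqP.
  rewrite -subr_eq0 addrAC subrr sub0r oppr_eq0 => /eqP PR.
  by rewrite -scalemxAr PR scaler0.
- by rewrite -scalemxAl mxtraceZ trRL mulr1.
Qed.

(** The blocks can be added because [P] separates them: it fixes the trace parts and annihilates the
    traceless ones. *)
Lemma noise_factorization (p t : C) :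
  eigenvalue Mp p -> eigenvalue Mt t ->
  (p != 0 -> nondefective Mp p) -> (t != 0 -> nondefective Mt t) ->
  exists L Rr : 'End('M[C]_d),
    [/\ expect (fun g => Gt g \o L \o unitary_channel_adj (U g))%VF
          = (L \o depolarizing d p t)%VF,
        expect (fun g => unitary_channel_adj (U g) \o Rr \o Gt g)%VF
          = (depolarizing d p t \o Rr)%VF,
        \tr ((Rr \o L)%VF 1%:M) = t * d%:R
      & \tr (m (Rr \o L)%VF) = t + (d ^ 2 - 1)%:R * p].
Proof.
move=> Mp_p Mt_t nd_p nd_t.
have d0 : d%:R != 0 :> C by rewrite pnatr_eq0 -lt0n ltnW.
have [Lt [Rt [MLt RMt LtP PRt trt]]] := trivial_block Mt_t nd_t.
have [Lu [Ru [HLu RHu LuP PRu tru]]] := traceless_block Mp_p nd_p.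
have [L LE] := matrix_of_surj B_basis (Lt + Lu).
have [Rr RE] := matrix_of_surj B_basis (Rt + Ru).
have DE : m (depolarizing d p t) = t *: P + p *: (1%:M - P).
  by rewrite /depolarizing matrix_ofD !matrix_ofZ matrix_of_traceless.
have PGT g : P *m (G g)^T = P.
  rewrite -matrix_of_adj// -matrix_ofM// /unitary_channel_adj trace_proj_unitary//.
  by rewrite trmxC_unitary.
have GTP g : (G g)^T *m P = P.
  rewrite -matrix_of_adj// -matrix_ofM// /unitary_channel_adj unitary_trace_proj//.
  by rewrite trmxC_unitary.
(* Cross terms have trace zero: a [P] released by the trace part moves around the trace and kills
   the traceless part. *)
have tr_tu : \tr (Rt *m Lu) = 0.
  by rewrite -PRt -mulmxA mxtrace_mulC -mulmxA LuP mulmx0 mxtrace0.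
have tr_ut : \tr (Ru *m Lt) = 0.
  by rewrite -LtP mulmxA mxtrace_mulC mulmxA PRu mul0mx mxtrace0.
exists L, Rr; split.
- apply: (matrix_of_inj B_basis); rewrite matrix_of_expect matrix_ofM// DE LE.
  (* Since [Lt = Lt P] and [P G^T = P], the ideal channel drops out of the trace part, which then
     sees only the average of [Gt]. *)
  rewrite (@eq_expect _ _ _ _ (fun g => H g *m Lt + H g *m Lu *m (G g)^T)).
    rewrite expectD HLu -mulmx_expectl -matrix_of_expect MLt.
    rewrite mulmxDr -!scalemxAr mulmxBr mulmx1 mulmxDl LtP LuP addr0.
    by rewrite addrAC subrr add0r.
  move=> g; rewrite !matrix_ofM// matrix_of_adj// LE mulmxDr mulmxDl.
  by rewrite -{1}LtP -!mulmxA PGT LtP.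
- apply: (matrix_of_inj B_basis); rewrite matrix_of_expect matrix_ofM// DE RE.
  rewrite (@eq_expect _ _ _ _ (fun g => Rt *m H g + (G g)^T *m Ru *m H g)).
    rewrite expectD RHu -mulmx_expectr -matrix_of_expect RMt.
    rewrite mulmxDl -!scalemxAl mulmxBl mul1mx mulmxDr PRt PRu addr0.
    by rewrite addrAC subrr add0r.
  move=> g; rewrite !matrix_ofM// matrix_of_adj// RE mulmxDr mulmxDl.
  by rewrite -{1}PRt mulmxA GTP PRt.
- rewrite (mxtrace_mul_trace_proj d0 B_basis) matrix_ofM// LE RE.
  by rewrite -mulmxA (mulmxDl Lt) LtP LuP addr0 mulmxDl mxtraceD trt tr_ut addr0.
- rewrite matrix_ofM// LE RE mulmxDl !mulmxDr !mxtraceD trt tru tr_tu tr_ut.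
  by rewrite addr0 add0r.
Qed.

End Assembly.

Unset Implicit Arguments.
Set Strict Implicit.

Theorem theorem2 (R : realType) (d : nat) (d_ge2 : (2 <= d)%N)
    (mu : probability (borel_mx R d) R) (mu_haar : haar_unitary mu)
    (gT : finGroupType) (U : gT -> 'M[Cplx R]_d)
    (U_group : unitary_group_mod_phase U) (U_2design : two_design mu U)
    (Gt : gT -> 'End('M[Cplx R]_d))
    (Gt_herm : forall g, hermiticity_preserving (Gt g))
    (B : 'I_(d ^ 2) -> 'M[Cplx R]_d) (B_basis : hermitian_basis B)
    (p t : Cplx R) :
  let Mp := expect (fun g =>
    matrix_of B (unitary_channel_u (U g)) *t matrix_of B (Gt g)) in
  let Mt := matrix_of B (expect Gt) in
  largest_eigenvalue Mp p -> largest_eigenvalue Mt t ->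
  (p != 0 -> nondefective Mp p) -> (t != 0 -> nondefective Mt t) ->
  exists L Rr : 'End('M[Cplx R]_d),
    [/\ expect (fun g => Gt g \o L \o unitary_channel_adj (U g))%VF
          = (L \o depolarizing d p t)%VF,
        expect (fun g => unitary_channel_adj (U g) \o Rr \o Gt g)%VF
          = (depolarizing d p t \o Rr)%VF
      & expect (fun g =>
          unitary_channel (U g) \o Rr \o L \o unitary_channel_adj (U g))%VF
          = depolarizing d p t].
Proof.
move=> Mp Mt [Mp_p _] [Mt_t _] nd_p nd_t.
have [Uu _ _] := U_group.
have [L [Rr [LE RE tr1 trm]]] :=
  noise_factorization d_ge2 B_basis Uu Mp_p Mt_t nd_p nd_t.
exists L, Rr; split => //.
(* The third average is the twirl of [Rr L] over the adjoints of the [U g], which equals the twirl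
   over the [U g]. *)
rewrite -(twirl_depolarizing d_ge2 mu_haar U_group U_2design B_basis tr1 trm).
rewrite -(twirl_adj U_group); apply: eq_expect => g.
apply/lfunP => A.
by rewrite /conjugate_map /unitary_channel_adj trmxCK !comp_lfunE.
Qed.
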